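(* Let $\alpha\ge\gamma>0$ be real numbers and let $(\delta_n)_{n\ge 0}$ be a strictly decreasing real sequence with $\lim_{n\to\infty}\delta_n=0$. Put $$\alpha_n=\frac12-\alpha\delta_n,\qquad \gamma_n=\frac12+\gamma\delta_n,\qquad n\ge 0,$$ and assume $\alpha_0=0$ (that is, $\alpha\delta_0=\frac12$). Let $(p_n)_{n\ge 0}$ be the real polynomials satisfying $$x p_n(x)=\gamma_n p_{n+1}(x)+\alpha_n p_{n-1}(x),\qquad n\ge 0,$$ where $p_{-1}=0$ and $p_0=1$. Then for $P_n(x)=\dfrac{p_n(x)}{p_n(1)}$ we have $$P_n(x)^2-P_{n-1}(x)P_{n+1}(x)\ge 0\qquad\text{for all } n\ge 1 \text{ and all } x\in[-1,1].$$
   Context: Since $\gamma_n\ne 0$ for all $n$, the recurrence together with $p_{-1}=0$, $p_0=1$ determines the polynomials $p_n$ uniquely. The values $p_n(1)$ are positive under the stated hypotheses, so $P_n$ is well defined. *)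

(* Defs.v *)
From HB Require Import structures.
From mathcomp Require Import all_boot all_order all_algebra.
From mathcomp Require Import all_classical all_reals all_analysis.

Set Implicit Arguments.
Unset Strict Implicit.
Unset Printing Implicit Defensive.

Import Order.TTheory GRing.Theory Num.Theory.
Import numFieldNormedType.Exports.

Local Open Scope classical_set_scope.
Local Open Scope ring_scope.

(* [p_(n-1)], with the convention [p_(-1) = 0]. *)
Definition prev_poly (R : nzRingType) (p : nat -> {poly R}) (n : nat) : {poly R} :=
  if n is m.+1 then p m else 0.

(* [x p_n = g_n p_(n+1) + a_n p_(n-1)] for all [n >= 0], with [p_(-1) = 0] and
   [p_0 = 1]: [a] multiplies the lower and [g] the higher neighbour. When no
   [g n] vanishes, exactly one [p] satisfies this. *)
Definition three_term_rec (R : nzRingType) (a g : nat -> R)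
    (p : nat -> {poly R}) : Prop :=
  p 0%N = 1 /\
  forall n : nat, 'X * p n = g n *: p n.+1 + a n *: prev_poly p n.

(* The value is meaningful only when [q.[1] != 0]. *)
Definition normalized_at1 (R : fieldType) (q : {poly R}) (x : R) : R :=
  q.[x] / q.[1].

(* Main.v *)
Require Import Defs.
From HB Require Import structures.
From mathcomp Require Import all_boot all_order all_algebra.
From mathcomp Require Import all_classical all_reals all_analysis.
From mathcomp Require Import ring lra.

Set Implicit Arguments.
Unset Strict Implicit.
Unset Printing Implicit Defensive.

Import Order.TTheory GRing.Theory Num.Theory.
Import numFieldNormedType.Exports.

Local Open Scope classical_set_scope.
Local Open Scope ring_scope.

(** Dividing by the values [v_n = p_n(1)] turns the recurrence into
    [x P_n = (1 - c_n) P_(n+1) + c_n P_(n-1)] with [c_n = alpha_n v_(n-1) / v_n],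
    the two coefficients adding up to [1] because [P_n(1) = 1].

    For a recurrence of this shape, the determinants
    [D_n = P_n^2 - P_(n-1) P_(n+1)] satisfy
    [(1 - c_(n+1)) D_(n+1)
       = c_n D_n + (c_(n+1) - c_n) (P_n^2 - P_(n+1)^2)].
    If [c] is nondecreasing, positivity therefore passes from [D_n] to
    [D_(n+1)] as long as [|P_(n+1)| <= |P_n|].  In the opposite case [D_(n+1)]
    is nonnegative by itself: [(1 - c_(n+1)) D_(n+1)] is a quadratic form in
    [(P_n, P_(n+1))] which, for [|x| <= 1] and [c_(n+1) <= 1/2], is at least
    [(|P_(n+1)| - |P_n|) ((1 - c_(n+1)) |P_(n+1)| - c_(n+1) |P_n|)].
    This is [turan_ge0].

    It remains to see that [c] is nondecreasing and at most [1/2].  As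
    [alpha_n] increases from [0] and stays below [1/2], it is enough that [v] be
    positive, nondecreasing and log-concave.  Monotonicity propagates because
    [alpha_n + gamma_n <= 1].  Log-concavity at [n+1] says that
    [gamma_(n+1) b^2 - a b + alpha_(n+1) a^2] is nonnegative at
    [(a, b) = (v_n, v_(n+1))], and this form equals
    [(b - a)^2 / 2 + delta_(n+1) (gamma b^2 - alpha a^2)].  If
    [gamma b^2 >= alpha a^2] it is clearly nonnegative; otherwise it only grows
    when [delta_n] is replaced by the smaller [delta_(n+1)], so log-concavity is
    inherited from the previous index.  This is [growth_at1]. *)

(** The case distinction behind the induction step: [a] and [b] stand for
    [P_n] and [P_(n+1)], and [e] for the contribution of the preceding
    determinant. *)
Lemma turan_form_ge0 (F : realFieldType) (c c' x a b e : F) :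
  c <= c' -> c' <= 1 / 2 -> 0 <= c -> `|x| <= 1 -> 0 <= e ->
  (1 - c') * b ^+ 2 + c' * a ^+ 2 - x * (a * b) =
    e + (c' - c) * (a ^+ 2 - b ^+ 2) ->
  0 <= (1 - c') * b ^+ 2 + c' * a ^+ 2 - x * (a * b).
Proof.
move=> le_cc' c'_le c_ge0 x_le1 e_ge0 formE.
have [le_ba|/ltW le_ab] := lerP `|b| `|a|.
  have le_sq : b ^+ 2 <= a ^+ 2.
    rewrite -(real_normK (num_real a)) -(real_normK (num_real b)).
    by rewrite lerXn2r ?nnegrE.
  by rewrite formE addr_ge0 // mulr_ge0 ?subr_ge0.
have le_xab : x * (a * b) <= `|a| * `|b|.
  apply: le_trans (ler_norm _) _; rewrite !normrM.
  by rewrite ler_piMl // mulr_ge0.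
rewrite -(real_normK (num_real a)) -(real_normK (num_real b)).
have := normr_ge0 a; move: le_ab le_xab; move: `|a| `|b| => s t le_st le_x s_ge0.
have : 0 <= (t - s) * ((1 - c') * t - c' * s) by apply: mulr_ge0; nra.
lra.
Qed.

Lemma turan_ge0 (F : realFieldType) (c P : nat -> F) (x : F) :
  c 0%N = 0 -> (forall n, c n <= c n.+1) -> (forall n, c n <= 1 / 2) ->
  `|x| <= 1 ->
  (forall n, x * P n = (1 - c n) * P n.+1 + c n * P n.-1) ->
  forall n, 0 <= P n.+1 ^+ 2 - P n * P n.+2.
Proof.
move=> c0 c_incr c_le x_le1 recP.
have c_ge0 n : 0 <= c n by elim: n => [|n IH]; rewrite ?c0 // (le_trans IH).
have step n : 0 <= c n * (P n ^+ 2 - P n.-1 * P n.+1) ->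
    0 <= P n.+1 ^+ 2 - P n * P n.+2.
  move=> e_ge0; have lt_c1 : 0 < 1 - c n.+1 by have := c_le n.+1; lra.
  rewrite -(pmulr_rge0 _ lt_c1).
  have -> : (1 - c n.+1) * (P n.+1 ^+ 2 - P n * P n.+2) =
      (1 - c n.+1) * P n.+1 ^+ 2 + c n.+1 * P n ^+ 2 - x * (P n * P n.+1).
    have := recP n.+1; rewrite /= => /(congr1 ( *%R (P n))); lra.
  apply: (turan_form_ge0 (c_incr n)) e_ge0 _ => //.
  have := recP n => /(congr1 ( *%R (P n.+1))); lra.
(* The determinant of index 0, which has no meaning, enters with weight c 0 = 0. *)
by elim=> [|n IH]; apply: step; rewrite ?c0 ?mul0r // mulr_ge0.
Qed.

Section GrowthAtOne.
Variables (F : realFieldType) (alpha gamma : F) (delta v : nat -> F).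
Hypotheses (le_ga : gamma <= alpha) (gamma_gt0 : 0 < gamma).
Hypotheses (delta_ge0 : forall n, 0 <= delta n)
           (delta_decr : forall n, delta n.+1 <= delta n).
Let alpha_ n := 1 / 2 - alpha * delta n.
Let gamma_ n := 1 / 2 + gamma * delta n.
Hypothesis alpha0 : alpha_ 0%N = 0.
(* At [n = 0] the predecessor is truncated to [0]; the factor [alpha_ 0 = 0] then
   does the work of the convention [v_(-1) = 0]. *)
Hypotheses (v0 : v 0%N = 1)
  (recv : forall n, v n = gamma_ n * v n.+1 + alpha_ n * v n.-1).

Lemma alpha_nondecr n : alpha_ n <= alpha_ n.+1.
Proof. by rewrite /alpha_ lerD2l lerN2 ler_wpM2l ?(le_trans (ltW gamma_gt0)). Qed.

Lemma alpha_ge0 n : 0 <= alpha_ n.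
Proof.
by elim: n => [|n IH]; rewrite ?alpha0 // (le_trans IH) ?alpha_nondecr.
Qed.

Lemma gamma_pos n : 0 < gamma_ n.
Proof. by rewrite /gamma_ ltr_pwDl ?mulr_ge0 // ?ltW //; lra. Qed.

Lemma alphaDgamma_le1 n : alpha_ n + gamma_ n <= 1.
Proof. rewrite /alpha_ /gamma_; have := ler_wpM2r (delta_ge0 n) le_ga; lra. Qed.

Let Q n a b := gamma_ n * b ^+ 2 - a * b + alpha_ n * a ^+ 2.

(** The coefficient of [delta] in the form is either nonnegative, and then every
    term is, or nonpositive, and then lowering [delta] raises the form. *)
Lemma form_ge0S n a b : 0 <= Q n a b -> 0 <= Q n.+1 a b.
Proof.
have QE m : Q m a b = (b - a) ^+ 2 / 2 + delta m * (gamma * b ^+ 2 - alpha * a ^+ 2).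
  by rewrite /Q /gamma_ /alpha_; field.
rewrite !QE; have [t_ge0 _|/ltW t_le0 Qn] := lerP 0 (gamma * b ^+ 2 - alpha * a ^+ 2).
  by rewrite addr_ge0 ?divr_ge0 ?sqr_ge0 ?mulr_ge0.
by apply: le_trans Qn _; rewrite lerD2l ler_wnM2r.
Qed.

(** The form at [(v n.+1, v n.+2)] is [alpha_ n.+1] times the log-concavity
    defect, which is why its sign at index [n] is the right induction
    hypothesis. *)
Lemma growth_at1 n :
  [/\ 0 < v n, v n <= v n.+1 & v n * v n.+2 <= v n.+1 ^+ 2].
Proof.
have logc m : 0 <= Q m (v m) (v m.+1) -> v m * v m.+2 <= v m.+1 ^+ 2.
  move=> /form_ge0S Qm; rewrite -subr_ge0 -(pmulr_rge0 _ (gamma_pos m.+1)).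
  move: Qm; congr (0 <= _); rewrite /Q.
  have := recv m.+1 => /= /(congr1 ( *%R (v m))); lra.
suff [? ? /logc] : [/\ 0 < v n, v n <= v n.+1 & 0 <= Q n (v n) (v n.+1)] by [].
elim: n => [|n [vn_gt0 le_v Qn]].
  have v1 : 1 = gamma_ 0 * v 1%N by have := recv 0; rewrite alpha0 v0 mul0r addr0.
  have g0_le1 : gamma_ 0 <= 1 by have := alphaDgamma_le1 0; rewrite alpha0 add0r.
  split; rewrite ?v0 //.
    by rewrite -(ler_pM2l (gamma_pos 0)) -v1 mulr1.
  by rewrite /Q alpha0 mul0r addr0 expr2 mulrA -v1 subrr.
have vn1_gt0 := lt_le_trans vn_gt0 le_v; have lc := logc _ Qn.
have rv := recv n.+1; rewrite /= in rv; split=> //.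
  rewrite -(ler_pM2l (gamma_pos n.+1)).
  have := ler_wpM2l (alpha_ge0 n.+1) le_v.
  have := ler_wpM2r (ltW vn1_gt0) (alphaDgamma_le1 n.+1); lra.
have -> : Q n.+1 (v n.+1) (v n.+2) =
    alpha_ n.+1 * (v n.+1 ^+ 2 - v n * v n.+2).
  by rewrite /Q; move: rv => /(congr1 ( *%R (v n.+2))); lra.
by rewrite mulr_ge0 ?alpha_ge0 // subr_ge0.
Qed.

(* The lower coefficient of the recurrence normalized at [1]. *)
Let c n := alpha_ n * v n.-1 / v n.

Lemma weight_nondecr n : c n <= c n.+1.
Proof.
have v_gt0 m : 0 < v m by have [] := growth_at1 m.
have v_ge0 m : 0 <= v m by rewrite ltW.
case: n => [|n].
  by rewrite /c alpha0 !mul0r divr_ge0 ?mulr_ge0 ?alpha_ge0.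
rewrite /c /= -!mulrA ler_pM ?alpha_ge0 ?alpha_nondecr ?divr_ge0 //.
rewrite ler_pdivrMr // mulrAC ler_pdivlMr // -expr2.
by have [] := growth_at1 n.
Qed.

Lemma weight_le_half n : c n <= 1 / 2.
Proof.
have [vn_gt0 _ _] := growth_at1 n.
have le_v : v n.-1 <= v n by case: n {vn_gt0} => // n; have [] := growth_at1 n.
rewrite /c ler_pdivrMr // ler_pM ?alpha_ge0 //.
- by case: (growth_at1 n.-1) => /ltW.
- by have := mulr_ge0 (le_trans (ltW gamma_gt0) le_ga) (delta_ge0 n); rewrite /alpha_; lra.
Qed.

End GrowthAtOne.

Theorem corollary1 (R : realType) (alpha gamma : R) (delta : nat -> R)
    (p : nat -> {poly R}) :
  gamma <= alpha -> 0 < gamma ->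
  decreasing_seq delta ->
  delta n @[n --> \oo] --> (0 : R) ->
  let alpha_ := fun n : nat => 1 / 2 - alpha * delta n in
  let gamma_ := fun n : nat => 1 / 2 + gamma * delta n in
  alpha_ 0%N = 0 ->
  three_term_rec alpha_ gamma_ p ->
  let P := fun n : nat => normalized_at1 (p n) in
  forall (n : nat) (x : R), (1 <= n)%N -> -1 <= x <= 1 ->
    0 <= P n x ^+ 2 - P n.-1 x * P n.+1 x.
Proof.
move=> le_ga gamma_gt0 delta_dec delta_cvg alpha_ gamma_ alpha0 [p0 recp] P.
have delta_decr n : delta n.+1 <= delta n by rewrite delta_dec.
have delta_ge0 n : 0 <= delta n.
  rewrite -(cvg_lim _ delta_cvg) //; apply: nonincreasing_cvgn_ge.
    by move=> i j le_ij; rewrite delta_dec.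
  by apply/cvg_ex; exists 0.
have rec_at y n : y * (p n).[y] =
    gamma_ n * (p n.+1).[y] + alpha_ n * (p n.-1).[y].
  have := congr1 (horner^~ y) (recp n); rewrite hornerD !hornerZ mulrC hornerMX.
  rewrite mulrC => ->; case: n => [|n] //=; by rewrite alpha0 !mul0r.
pose v n := (p n).[1].
have v0 : v 0%N = 1 by rewrite /v p0 hornerC.
have recv n : v n = gamma_ n * v n.+1 + alpha_ n * v n.-1.
  by rewrite -rec_at mul1r.
have v_gt0 n : 0 < v n.
  by have [] := growth_at1 le_ga gamma_gt0 delta_ge0 delta_decr alpha0 v0 recv n.
case=> [|n] x // _ x_le1.
pose c n := alpha_ n * v n.-1 / v n.
apply: (@turan_ge0 _ c (fun m => P m x) x).
- by rewrite /c alpha0 !mul0r.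
- exact: (weight_nondecr le_ga gamma_gt0 delta_ge0 delta_decr alpha0 v0 recv).
- exact: (weight_le_half le_ga gamma_gt0 delta_ge0 delta_decr alpha0 v0 recv).
- by rewrite ler_norml.
move=> m; rewrite /P /normalized_at1 -!/(v _) mulrA rec_at.
have -> : 1 - c m = gamma_ m * v m.+1 / v m.
  apply: (mulIf (lt0r_neq0 (v_gt0 m))).
  by rewrite mulrBl mul1r /c !divfK ?lt0r_neq0 // {1}(recv m) addrK.
by rewrite /c; field; rewrite !lt0r_neq0.
Qed.
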